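(* For any lacunary sequence $\theta=(k_r)$, one has $|\Delta\sigma^{0}_{1}|\subset \Delta N^{0}_{\theta}$ if and only if $\liminf_{r} q_r>1$.
   Context: All sequences are sequences of real numbers. A lacunary sequence is an increasing sequence of integers $\theta=(k_r)_{r\ge 0}$ with $k_0=0$ and $h_r:=k_r-k_{r-1}\to\infty$. Put $I_r=(k_{r-1},k_r]$ (integers in this interval) and $q_r=k_r/k_{r-1}$ (for $r\ge 2$). For a sequence $(\alpha_k)_{k\ge1}$, $\Delta\alpha_k=\alpha_{k+1}-\alpha_k$. $|\Delta\sigma_1^0|$ denotes the set of strongly Cesàro quasi-Cauchy sequences, i.e. those with $\lim_{n\to\infty}\frac1n\sum_{i=1}^n|\Delta\alpha_i|=0$. $\Delta N_\theta^0$ denotes the set of $N_\theta$-quasi-Cauchy sequences, i.e. those with $\lim_{r\to\infty}\frac1{h_r}\sum_{k\in I_r}|\Delta\alpha_k|=0$. *)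

(* Defs.v *)
From mathcomp Require Import all_boot all_order all_algebra.
From mathcomp Require Import all_classical all_reals all_analysis.
Import Order.TTheory GRing.Theory Num.Theory.
Import numFieldNormedType.Exports.

Set Implicit Arguments.
Unset Strict Implicit.
Unset Printing Implicit Defensive.

Local Open Scope classical_set_scope.
Local Open Scope ring_scope.

(* [lac_h], [lac_q] and the sums over I_r are meant for r >= 1, r >= 2 and
   r >= 1.  Their values at smaller r are junk (r.-1 = 0 at r = 0, and division
   by 0 gives 0), but only limits as r tends to infinity are ever taken. *)
Definition lac_h (k : nat -> nat) (r : nat) : nat := (k r - k r.-1)%N.

Definition lac_q (R : realType) (k : nat -> nat) (r : nat) : R :=
  (k r)%:R / (k r.-1)%:R.

(* An increasing sequence of integers starting at 0 has natural number values;
   [increasing_seq] is strict monotonicity. *)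
Definition lacunary (k : nat -> nat) : Prop :=
  [/\ k 0%N = 0%N, increasing_seq k & lac_h k r @[r --> \oo] --> \oo].

(* A sequence (alpha_i)_{i >= 1} is a function on nat whose value at 0 is never
   used; [telescope alpha i] is alpha_{i+1} - alpha_i. *)
Definition strongly_cesaro_quasi_cauchy (R : realType) : set (R^nat) :=
  [set alpha : R^nat |
    n%:R^-1 * (\sum_(1 <= i < n.+1) `|telescope alpha i|) @[n --> \oo] --> (0 : R)].

Definition Ntheta_quasi_cauchy (R : realType) (k : nat -> nat) : set (R^nat) :=
  [set alpha : R^nat |
    (lac_h k r)%:R^-1 * (\sum_((k r.-1).+1 <= i < (k r).+1) `|telescope alpha i|)
      @[r --> \oo] --> (0 : R)].

Arguments strongly_cesaro_quasi_cauchy : clear implicits.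
Arguments Ntheta_quasi_cauchy : clear implicits.
Arguments lac_q : clear implicits.

(* Main.v *)
(* Since k_r / h_r = q_r / (q_r - 1), a lower bound q_r >= m > 1 makes the mean
   over I_r at most m / (m - 1) times the Cesàro mean up to k_r.  Conversely, if
   liminf q_r <= 1, one can pick blocks I_s(1), I_s(2), ... such that both h_s(j)
   and k_s(j-1) are small compared to the left end k_(s(j)-1) of I_s(j).  The
   sequence whose differences are 1 on these blocks and 0 elsewhere has means 1
   over them, but its Cesàro means tend to 0. *)
Require Import Defs.
From mathcomp Require Import all_boot all_order all_algebra.
From mathcomp Require Import all_classical all_reals all_analysis.
From mathcomp Require Import zify lra.
Import Order.TTheory GRing.Theory Num.Theory.
Import numFieldNormedType.Exports.
Local Open Scope classical_set_scope.
Local Open Scope ring_scope.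

(** The liminf is the supremum of the infima over tails, so it exceeds [l] exactly when one of these
    infima does. That infimum serves as [m]; it is finite because it lies between [l] and a term of
    [u]. *)
Lemma limn_einf_gtP (R : realType) (u : nat -> R) (l : R) :
  (l%:E < limn_einf (fun n => (u n)%:E))%E <->
  exists2 m, l < m & \forall n \near \oo, m <= u n.
Proof.
rewrite limn_einf_lim; have /cvg_lim -> // := @cvg_einfs_sup R (fun n => (u n)%:E).
split.
- move=> /ereal_sup_gt[_ [N _ <-]] lN.
  have inf_le n : (N <= n)%N -> (einfs (fun n => (u n)%:E) N <= (u n)%:E)%E.
    by move=> Nn; apply: ereal_inf_lbound; exists n.
  move: lN inf_le; case: (einfs _ N) => [m| |] // lm inf_le.
  + by exists m; [rewrite -lte_fin | exists N => // n /inf_le; rewrite lee_fin].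
  + by have := inf_le N (leqnn N).
- move=> [m lm [N _ mu]]; apply: (@lt_le_trans _ _ m%:E); first by rewrite lte_fin.
  apply: (@le_trans _ _ (einfs (fun n => (u n)%:E) N)).
    by apply: le_ereal_inf_tmp => _ [n Nn <-]; rewrite lee_fin; exact: mu.
  by apply: ereal_sup_ubound; exists N.
Qed.

(** The relation depends on the stage [j], so that the smallness required of a block can grow
    stricter along the recursion. *)
Lemma dependent_choice_indexed (P : nat -> nat -> nat -> Prop) :
  (forall j m, exists r, P j m r) -> exists phi, forall j, P j (phi j) (phi j.+1).
Proof.
move=> Pex; have [f Pf] := choice (fun jm : nat * nat => Pex jm.1 jm.2).
exists (fix phi j := if j is i.+1 then f (i, phi i) else 0%N) => j.
exact: (Pf (j, _)).
Qed.

Lemma sum_interval_le (n a b : nat) :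
  (\sum_(1 <= i < n.+1) (a < i <= b) <= b - a)%N.
Proof.
rewrite -big_mkcond sum1_count -size_filter.
have <- : size (index_iota a.+1 b.+1) = (b - a)%N by rewrite size_iota subSS.
apply: uniq_leq_size => [|i]; first by rewrite filter_uniq ?iota_uniq.
by rewrite mem_filter !mem_index_iota ltnS => /andP[].
Qed.

Section Lacunary.
Variables (R : realType) (k : nat -> nat).
Hypothesis k_lac : lacunary k.

Lemma lacunary_leq (m n : nat) : (k m <= k n)%N = (m <= n)%N.
Proof. by case: k_lac => _ kmono _; have := kmono m n. Qed.

Lemma lacunary_ltn (m n : nat) : (k m < k n)%N = (m < n)%N.
Proof. by rewrite !ltnNge lacunary_leq. Qed.

Lemma lacunary_ge_id (n : nat) : (n <= k n)%N.
Proof.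
elim: n => // n IHn; apply: (leq_ltn_trans IHn).
by rewrite lacunary_ltn.
Qed.

Lemma Ntheta_of_cesaro (m : R) (m_gt1 : 1 < m)
    (m_le : \forall r \near \oo, m <= lac_q R k r) :
  strongly_cesaro_quasi_cauchy R `<=` Ntheta_quasi_cauchy R k.
Proof.
move=> alpha; rewrite /strongly_cesaro_quasi_cauchy /Ntheta_quasi_cauchy /=.
set C := fun n : nat => _ => C_cvg0.
have k_cvgy : k r @[r --> \oo] --> \oo.
  apply/cvgnyPge => A; exists A => // r /= Ar.
  exact: leq_trans Ar (lacunary_ge_id r).
have Ck_cvg0 : m / (m - 1) * C (k r) @[r --> \oo] --> (0 : R).
  rewrite -[0 in X in _ --> X](mulr0 (m / (m - 1))).
  by apply: cvgMr; exact: (cvg_comp _ _ k_cvgy C_cvg0).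
apply: (squeeze_cvgr _ (cvg_cst 0) Ck_cvg0).
near=> r.
(* From r = 2 on, k_(r-1) > 0 and q_r is a genuine quotient. *)
have r_gt1 : (1 < r)%N by near: r; exact: nbhs_infty_gt.
have kr1_gt0 : (0 < k r.-1)%N by apply: leq_trans (lacunary_ge_id _); lia.
have kr_lt : (k r.-1 < k r)%N by rewrite lacunary_ltn; lia.
have m_le_r : m <= lac_q R k r by near: r.
rewrite mulr_ge0 ?invr_ge0 ?ler0n ?sumr_ge0//=.
set S := \sum_(_ <= i < _) _.
have S_le : S <= \sum_(1 <= i < (k r).+1) `|telescope alpha i|.
  rewrite [leRHS](@big_cat_nat _ _ _ (k r.-1).+1) ?ltnS 1?ltnW//=.
  by rewrite lerDr sumr_ge0.
rewrite /C mulrA; apply: ler_pM => //; rewrite ?invr_ge0 ?sumr_ge0//.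
rewrite /lac_h natrB 1?ltnW//.
move: m_le_r; rewrite /lac_q ler_pdivlMr ?ltr0n// => m_le_r.
have kr1R : 0 < (k r.-1)%:R :> R by rewrite ltr0n.
have krR : (k r.-1)%:R < (k r)%:R :> R by rewrite ltr_nat.
have m_gt0 : 0 < m by exact: lt_trans m_gt1.
have krR_gt0 : 0 < (k r)%:R :> R by exact: lt_trans krR.
(* Inverting both sides leaves (m - 1) / m * k_r <= h_r, which is m * k_(r-1) <= k_r rearranged. *)
rewrite -[m / _]invf_div -invfM lef_pV2 ?posrE ?mulr_gt0 ?invr_gt0 ?subr_gt0//.
rewrite mulrAC ler_pdivrMr//; lra.
Unshelve. all: by end_near. Qed.

(** Here [m] is the index chosen before and [r] the next one. Multiplying by j + 1 instead of
    dividing keeps the conditions in [nat]. *)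
Definition sparse_step (j m r : nat) : Prop :=
  [/\ (m < r)%N, (j.+1 * lac_h k r <= k r.-1)%N & (j.+1 * k m <= k r.-1)%N].

(** If no [r] qualified, every large [r] would fail the condition on h_r alone, which forces q_r > 1
    + 1 / (j + 1) eventually. *)
Lemma sparse_stepP :
  ~ (exists2 m : R, 1 < m & \forall r \near \oo, m <= lac_q R k r) ->
  forall j m, exists r, sparse_step j m r.
Proof.
move=> q_near1 j m; apply/not_existsP => no_r; apply: q_near1.
exists (1 + j.+1%:R^-1); first by rewrite ltrDl invr_gt0 ltr0n.
(* Since k_(r-1) >= r - 1, this threshold secures k_(r-1) > 0 and the first and third conditions of
   [sparse_step]. *)
exists (m + j.+1 * k m).+2 => // r /= r_big.
have kr1_ge := lacunary_ge_id r.-1.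
have kr1_gt0 : (0 < k r.-1)%N by lia.
have kr_lt : (k r.-1 < k r)%N by rewrite lacunary_ltn; lia.
rewrite leNgt; apply/negP => q_lt; apply: (no_r r); split; [lia| |lia].
have jR : 0 < j.+1%:R :> R by rewrite ltr0n.
move: q_lt; rewrite /lac_q ltr_pdivrMr ?ltr0n// mulrDl mul1r -ltrBlDl.
rewrite -natrB ?(ltnW kr_lt)// mulrC ltr_pdivlMr// -natrM ltr_nat.
by rewrite /lac_h mulnC => /ltnW.
Qed.

Section Sparse.
Variable phi : nat -> nat.
Hypothesis phi_sparse : forall j, sparse_step j (phi j) (phi j.+1).

(** [phi 0] only starts the recursion; the chosen blocks begin with [phi 1]. *)
Definition in_sparse_block (i : nat) : bool :=
  `[< exists j, (k (phi j.+1).-1 < i <= k (phi j.+1))%N >].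

Lemma sparse_lt (j : nat) : (phi j < phi j.+1)%N.
Proof. by case: (phi_sparse j). Qed.

Lemma sparse_homo : {homo phi : i j / (i <= j)%N}.
Proof.
apply: homo_leq => //; first by move=> ? ? ?; exact: leq_trans.
by move=> j; rewrite ltnW// sparse_lt.
Qed.

(** A marked i <= n lies in block [phi j.+1] or in an earlier one, hence below k (phi j), because
    later blocks start at or after n. The length of block [phi j.+1] and k (phi j) are each at most
    n / (j + 1), whence the factor 2. *)
Lemma sparse_count_bound (j n : nat) :
  (k (phi j.+1).-1 <= n <= k (phi j.+2).-1)%N ->
  (j.+1 * \sum_(1 <= i < n.+1) in_sparse_block i <= 2 * n)%N.
Proof.
move=> /andP[n_ge n_le]; case: (phi_sparse j) => _ h_small k_small.
have S_le : (\sum_(1 <= i < n.+1) in_sparse_block i <=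
             k (phi j) + lac_h k (phi j.+1))%N.
  apply: (@leq_trans (\sum_(1 <= i < n.+1) ((0 < i <= k (phi j)) +
      (k (phi j.+1).-1 < i <= k (phi j.+1))))%N); last first.
    by rewrite big_split leq_add ?(leq_trans (sum_interval_le _ _ _))// subn0.
  rewrite big_nat_cond [leqRHS]big_nat_cond.
  apply: leq_sum => i /andP[/andP[i_gt0 i_le] _].
  case: (boolP (in_sparse_block i)) => // /asboolP[j' /andP[i_lo i_hi]].
  have [j'j|jj'|<-] := ltngtP j' j.
  - suff -> : (i <= k (phi j))%N by rewrite i_gt0.
    by apply: (leq_trans i_hi); rewrite lacunary_leq sparse_homo.
  - have : (k (phi j.+2).-1 <= k (phi j'.+1).-1)%N.
      rewrite lacunary_leq; have := sparse_homo j.+2 j'.+1 jj'; lia.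
    lia.
  - by rewrite i_lo i_hi addn1.
apply: (leq_trans (leq_mul (leqnn j.+1) S_le)); lia.
Qed.

(** The previous bound applies to the largest [j] whose block starts no later than [n], and this [j]
    is at least [N]. *)
Lemma sparse_count_small (N n : nat) : (k (phi N.+1).-1 <= n)%N ->
  (N.+1 * \sum_(1 <= i < n.+1) in_sparse_block i <= 2 * n)%N.
Proof.
move=> n_ge; pose P j := (k (phi j.+1).-1 <= n)%N.
have P_bound j : P j -> (j <= n.+1)%N.
  have phi_ge : (j.+1 <= phi j.+1)%N.
    elim: j.+1 => // i; have := sparse_lt i; lia.
  have := lacunary_ge_id (phi j.+1).-1; rewrite /P; lia.
have P_ex : exists j, P j by exists N.
case: (ex_maxnP P_ex P_bound) => j Pj j_max.
have /sparse_count_bound S_le : (k (phi j.+1).-1 <= n <= k (phi j.+2).-1)%N.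
  rewrite [X in X && _]Pj /= leqNgt; apply/negP => /ltnW /j_max; lia.
by apply: leq_trans S_le; rewrite leq_mul2r ltnS j_max// orbT.
Qed.

(** [series] sums the terms before its index, so [telescope] returns the indicator without a
    shift. *)
Definition sparse_witness : R^nat := series (fun i => (in_sparse_block i)%:R).

Lemma sum_sparse_witness (m n : nat) :
  \sum_(m <= i < n) `|telescope sparse_witness i| =
  (\sum_(m <= i < n) in_sparse_block i)%N%:R.
Proof.
rewrite natr_sum /sparse_witness seriesK.
by apply: eq_bigr => i _; rewrite normr_nat.
Qed.

Lemma sparse_witness_cesaro : strongly_cesaro_quasi_cauchy R sparse_witness.
Proof.
apply/cvgr0Pnorm_le => e e_gt0.
(* The Cesàro means will be at most 2 / (N + 1), which this [N] brings below [e]. *)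
have [N _ /(_ N (leqnn N)) /= N_big] := nbhs_infty_ger (2 / e).
exists (k (phi N.+1).-1).+1 => // n /= n_big.
rewrite sum_sparse_witness ger0_norm ?mulr_ge0 ?invr_ge0//.
have n_gt0 : 0 < n%:R :> R by rewrite ltr0n; lia.
rewrite ler_pdivrMl//.
have := @sparse_count_small N n (ltnW n_big).
rewrite -(ler_nat R) !natrM; set S := _%:R => S_le.
have e_big : 2 <= e * N.+1%:R.
  move: N_big; rewrite ler_pdivrMr// => N_big.
  by rewrite -[N.+1%:R]natr1 mulrDr mulr1 mulrC; lra.
rewrite -(@ler_pM2l _ N.+1%:R) ?ltr0n// (le_trans S_le)//.
by rewrite mulrCA mulrC ler_pM2l// mulrC.
Qed.

Lemma sparse_witness_not_Ntheta : ~ Ntheta_quasi_cauchy R k sparse_witness.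
Proof.
(* Beyond any threshold [N] lies the block [phi N.+1], whose mean is exactly 1, so tolerance 1
   already fails. *)
move=> /cvgr0_norm_lt /(_ 1 ltr01)[N _ /(_ (phi N.+1))] /=.
have phi_ge j : (j <= phi j)%N.
  elim: j => // j; have := sparse_lt j; lia.
move=> /(_ (leq_trans (leqnSn N) (phi_ge _))).
have kr_lt : (k (phi N.+1).-1 < k (phi N.+1))%N.
  by rewrite lacunary_ltn; have := sparse_lt N; lia.
rewrite sum_sparse_witness.
rewrite (eq_big_nat _ _ (F2 := fun=> 1%N)) => [|i i_in]; last first.
  by rewrite (_ : in_sparse_block i)//; apply/asboolP; exists N.
by rewrite sum_nat_const_nat muln1 subSS mulVf ?normr1 ?ltxx// pnatr_eq0 /lac_h; lia.
Qed.

End Sparse.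
End Lacunary.

Theorem theorem7 (R : realType) (k : nat -> nat) (hk : lacunary k) :
  strongly_cesaro_quasi_cauchy R `<=` Ntheta_quasi_cauchy R k
  <-> (1 < limn_einf (fun r : nat => (lac_q R k r)%:E))%E.
Proof.
rewrite limn_einf_gtP; split; last by move=> [m]; exact: Ntheta_of_cesaro.
move=> cesaro_Ntheta; apply: contrapT => q_near1.
have [phi phi_sparse] := dependent_choice_indexed _ (sparse_stepP _ _ hk q_near1).
apply: (sparse_witness_not_Ntheta R _ hk _ phi_sparse).
by apply: cesaro_Ntheta; exact: sparse_witness_cesaro.
Qed.
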